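(* There is a tall $F_\sigma$ ideal $\mathcal{I}$ on $\mathbb{N}$ which does not have a Borel selector.
   Context: Subsets of $\mathbb{N}$ are identified with elements of $2^{\mathbb{N}}$ (with the product topology). An ideal on $\mathbb{N}$ is a family $\mathcal{I}\subseteq 2^{\mathbb{N}}$ that is hereditary (if $y\subseteq x\in\mathcal{I}$ then $y\in\mathcal{I}$) and closed under finite unions; it is $F_\sigma$ if it is an $F_\sigma$ subset of $2^{\mathbb{N}}$. A family $\mathcal{C}\subseteq 2^{\mathbb{N}}$ is tall if every infinite $x\subseteq\mathbb{N}$ has an infinite subset $y\in\mathcal{C}$. A Borel selector for a tall family $\mathcal{C}$ is a Borel function $S:2^{\mathbb{N}}\to 2^{\mathbb{N}}$ such that for every $x\in 2^{\mathbb{N}}$: $S(x)\subseteq x$, $S(x)\in\mathcal{C}$, and $S(x)$ is infinite whenever $x$ is infinite. *)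

(* Defs.v *)
(* Cantor space 2^N = nat -> bool, subsets of N identified
   with their characteristic functions. *)
From Stdlib Require Import Arith.

Definition cantor := nat -> bool.

Definition subsetc (y x : cantor) : Prop := forall n, y n = true -> x n = true.

Definition unionc (x y : cantor) : cantor := fun n => orb (x n) (y n).

Definition emptyc : cantor := fun _ => false.

Definition infinitec (x : cantor) : Prop :=
  forall m, exists n, m <= n /\ x n = true.

(* Product topology on 2^N: U is open iff every point of U has a basic
   cylinder neighbourhood (agreement on an initial segment) inside U. *)
Definition is_open (U : cantor -> Prop) : Prop :=
  forall x, U x -> exists k, forall y, (forall i, i < k -> y i = x i) -> U y.

Definition is_closed (F : cantor -> Prop) : Prop :=
  is_open (fun x => ~ F x).

Definition is_Fsigma (A : cantor -> Prop) : Prop :=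
  exists F : nat -> cantor -> Prop,
    (forall n, is_closed (F n)) /\ (forall x, A x <-> exists n, F n x).

Inductive borel : (cantor -> Prop) -> Prop :=
| borel_open : forall U, is_open U -> borel U
| borel_compl : forall A, borel A -> borel (fun x => ~ A x)
| borel_cunion : forall A : nat -> cantor -> Prop,
    (forall n, borel (A n)) -> borel (fun x => exists n, A n x)
| borel_ext : forall A B, borel A -> (forall x, A x <-> B x) -> borel B.

Definition borel_fun (S : cantor -> cantor) : Prop :=
  forall U, is_open U -> borel (fun x => U (S x)).

Definition is_ideal (I : cantor -> Prop) : Prop :=
  I emptyc /\
  (forall x y, subsetc y x -> I x -> I y) /\
  (forall x y, I x -> I y -> I (unionc x y)).

Definition tall (C : cantor -> Prop) : Prop :=
  forall x, infinitec x -> exists y, subsetc y x /\ infinitec y /\ C y.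

Definition borel_selector (C : cantor -> Prop) (S : cantor -> cantor) : Prop :=
  borel_fun S /\
  forall x, subsetc (S x) x /\ C (S x) /\ (infinitec x -> infinitec (S x)).

(* Main.v *)
(* There are closed relations R0, R1 on cantor x baire whose projections cover the Cantor
   space, such that no Borel set D satisfies both [D a -> exists w, R1 a w] and
   [~ D a -> exists w, R0 a w]: let [a] code two trees, and let w be a level-preserving map
   from one of them to the other.  Each R gives a closed hereditary family C(R) of sets
   converging to some [a] and growing faster than some w with [R a w].  Every infinite set
   has a subset converging to some [a], which can be thinned into C(R0) or C(R1); hence the
   two families generate a tall F_sigma ideal.  If S were a Borel selector and [x_a] a set
   converging to [a] that depends continuously on [a], the Borel set of all [a] for which
   [S x_a] is in the ideal generated by C(R1) alone would be a forbidden D. *)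

Require Import Defs.
From Stdlib Require Import Arith Lia List Bool Classical ClassicalEpsilon IndefiniteDescription Cantor.
Import ListNotations.

(** * Finite agreement, pigeonhole and compactness *)

Definition agree {X : Type} (L : nat) (f g : nat -> X) : Prop :=
  forall i, i < L -> f i = g i.

Definition dec_prop (P : Prop) : bool :=
  if excluded_middle_informative P then true else false.

Lemma dec_propP (P : Prop) : dec_prop P = true <-> P.
Proof. unfold dec_prop; destruct (excluded_middle_informative P); split; easy. Qed.

Lemma eventually_all (Q : nat -> nat -> Prop) :
  (forall j, exists N, forall m, N <= m -> Q j m) ->
  forall L, exists N, forall m, N <= m -> forall j, j < L -> Q j m.
Proof.
  intros H L; induction L as [|L [N IH]].
  - exists 0; intros; lia.
  - destruct (H L) as [N' H']. exists (N + N'); intros m Hm j Hj.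
    destruct (Nat.eq_dec j L) as [->|]; [apply H'; lia | apply IH; lia].
Qed.

Lemma pigeonhole (Q : nat -> Prop) (f : nat -> nat) (b : nat) :
  (forall M, exists m, M <= m /\ Q m /\ f m <= b) ->
  exists v, forall M, exists m, M <= m /\ Q m /\ f m = v.
Proof.
  induction b as [|b IH]; intros H.
  - exists 0; intros M; destruct (H M) as [m ?]; exists m; intuition lia.
  - destruct (classic (forall M, exists m, M <= m /\ Q m /\ f m = S b)) as [|n]; [now exists (S b)|].
    apply not_all_ex_not in n as [M0 n].
    apply IH; intros M. destruct (H (M + M0)) as [m (h1 & h2 & h3)].
    exists m; repeat split; [lia | easy |].
    destruct (Nat.eq_dec (f m) (S b)); [|lia].
    exfalso; apply n; exists m; repeat split; auto; lia.
Qed.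

(** Compactness in Baire space, with coordinate [j] bounded only from a stage depending on [j]. The
    limit is built one coordinate at a time, each value being shared by cofinally many of the
    indices that agree so far. *)
Lemma bounded_cluster_point (f : nat -> nat -> nat) :
  (forall j, exists b, forall m, b <= m -> f m j <= b) ->
  exists g, forall L M, exists m, M <= m /\ agree L (f m) g.
Proof.
  intros Hb.
  set (P := fun k (g : nat -> nat) => forall M, exists m, M <= m /\ agree k (f m) g).
  set (upd := fun (g : nat -> nat) k v j => if j =? k then v else g j).
  assert (step : forall kg, exists v, P (fst kg) (snd kg) ->
                 P (S (fst kg)) (upd (snd kg) (fst kg) v)).
  { intros [k g]; simpl. destruct (classic (P k g)) as [h|]; [|exists 0; tauto].
    destruct (Hb k) as [b Hk].
    destruct (pigeonhole (fun m => agree k (f m) g) (fun m => f m k) b) as [v Hv].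
    { intros M. destruct (h (M + b)) as [m [h1 h2]].
      exists m; repeat split; [lia | easy | apply Hk; lia]. }
    exists v; intros _ M. destruct (Hv M) as [m (h1 & h2 & h3)].
    exists m; split; [easy|]. intros i Hi. unfold upd.
    destruct (Nat.eqb_spec i k) as [->|]; [easy | apply h2; lia]. }
  apply functional_choice in step as [v Hv].
  set (G := fix G k := match k with 0 => fun _ => 0
                       | S k => upd (G k) k (v (k, G k)) end).
  assert (HG : forall k, P k (G k)).
  { induction k as [|k IH]; [intros M; exists M; split; [lia | intros i Hi; lia]|].
    apply (Hv (k, G k)), IH. }
  assert (stable : forall k j, j < k -> G k j = G (S j) j).
  { induction k as [|k IH]; intros j Hj; [lia|].
    destruct (Nat.eq_dec j k) as [->|]; [easy|].
    rewrite <- IH by lia. simpl. unfold upd at 1.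
    destruct (Nat.eqb_spec j k); [lia | easy]. }
  exists (fun j => G (S j) j). intros L M.
  destruct (HG L M) as [m [h1 h2]]. exists m; split; [easy|].
  intros i Hi. rewrite h2 by easy. now apply stable.
Qed.

(** * Analytic sets as projections of closed relations *)

Definition baire := nat -> nat.

Definition closed_rel (R : cantor -> baire -> Prop) : Prop :=
  forall a w,
    (forall L, exists a' w', R a' w' /\ agree L a' a /\ agree L w' w) -> R a w.

Definition analytic (A : cantor -> Prop) : Prop :=
  exists R, closed_rel R /\ forall a, A a <-> exists w, R a w.

Lemma analytic_ext (A B : cantor -> Prop) :
  (forall a, A a <-> B a) -> analytic A -> analytic B.
Proof.
  intros E [R [cR hR]]. exists R; split; [easy|].
  intros a; rewrite <- E; apply hR.
Qed.

(** The first entry of a witness selects the index, which nearby witnesses therefore share. *)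
Lemma analytic_cunion (A : nat -> cantor -> Prop) :
  (forall n, analytic (A n)) -> analytic (fun a => exists n, A n a).
Proof.
  intros H. apply functional_choice in H as [R HR].
  exists (fun a w => R (w 0) a (fun i => w (S i))); split.
  - intros a w H. apply HR. intros L. destruct (H (S L)) as (a' & w' & h1 & h2 & h3).
    exists a', (fun i => w' (S i)). rewrite <- (h3 0) by lia.
    split; [easy|]; split; intros i Hi; [apply h2 | apply h3]; lia.
  - intros a; split.
    + intros [n h]. apply HR in h as [w h].
      now exists (fun i => match i with 0 => n | S i => w i end).
    + intros [w h]. exists (w 0). apply HR. eauto.
Qed.

Lemma analytic_cinter (A : nat -> cantor -> Prop) :
  (forall n, analytic (A n)) -> analytic (fun a => forall n, A n a).
Proof.
  intros H. apply functional_choice in H as [R HR].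
  exists (fun a w => forall n, R n a (fun i => w (to_nat (n, i)))); split.
  - intros a w H n. apply HR. intros L.
    destruct (eventually_all (fun i m => to_nat (n, i) < m)) with (L := L) as [N HN].
    { intros j; exists (S (to_nat (n, j))); lia. }
    destruct (H (L + N)) as (a' & w' & h1 & h2 & h3).
    exists a', (fun i => w' (to_nat (n, i))).
    split; [easy|]; split; intros i Hi; [apply h2; lia | apply h3, HN; lia].
  - intros a; split.
    + intros h. assert (h' : forall n, exists w, R n a w) by (intros n; now apply HR).
      apply functional_choice in h' as [w h'].
      exists (fun k => let (n, i) := of_nat k in w n i). intros n.
      (* The decoded row equals [w n] only pointwise; closedness of [R n] stands in for
         extensionality. *)
      apply HR. intros L. exists a, (w n). repeat split; [easy | ].
      intros i _. now rewrite cancel_of_to.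
    + intros [w h] n. apply HR. eauto.
Qed.

(** Complementation swaps the two halves, so the induction has to carry both. *)
Lemma borel_bianalytic (A : cantor -> Prop) :
  borel A -> analytic A /\ analytic (fun a => ~ A a).
Proof.
  induction 1 as [U oU | A _ [h1 h2] | A _ IH | A B _ [h1 h2] E].
  - split.
    + exists (fun a w => forall y, agree (w 0) y a -> U y); split.
      * intros a w H y Hy. destruct (H (S (w 0))) as (a' & w' & h1 & h2 & h3).
        apply h1. rewrite h3 by lia. intros i Hi.
        rewrite (h2 i) by lia. now apply Hy.
      * intros a; split.
        -- intros h. apply oU in h as [k h]. now exists (fun _ => k).
        -- intros [w h]. apply h. now intros i _.
    + exists (fun a _ => ~ U a); split.
      * intros a w H h. apply oU in h as [k h].
        destruct (H k) as (a' & w' & h1 & h2 & _). now apply h1, h.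
      * intros a; split; [now exists (fun _ => 0) | now intros [_ h]].
  - split; [easy|]. revert h1; apply analytic_ext. intros a; tauto.
  - split.
    + apply analytic_cunion; intros n; apply IH.
    + apply analytic_ext with (fun a => forall n, ~ A n a).
      * intros a; split; [intros h [n h']; now apply (h n) | intros h n h'; eauto].
      * apply analytic_cinter; intros n; apply IH.
  - split; [revert h1 | revert h2]; apply analytic_ext; intros a; rewrite E; tauto.
Qed.

Lemma borel_continuous_preimage (f : cantor -> cantor) (A : cantor -> Prop) :
  (forall x k, exists l, forall y, agree l y x -> agree k (f y) (f x)) ->
  borel A -> borel (fun a => A (f a)).
Proof.
  intros cf. induction 1 as [U oU | A _ IH | A _ IH | A B _ IH E].
  - apply borel_open. intros x h. apply oU in h as [k h].
    destruct (cf x k) as [l Hl]. exists l; intros y Hy. now apply h, Hl.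
  - now apply borel_compl with (A := fun a => A (f a)).
  - now apply borel_cunion with (A := fun n a => A n (f a)).
  - apply borel_ext with (fun a => A (f a)); [easy | intros; apply E].
Qed.

(** * Coding of finite sequences *)

Fixpoint encode (s : list nat) : nat :=
  match s with [] => 0 | n :: s => S (to_nat (n, encode s)) end.

Lemma encode_inj (s t : list nat) : encode s = encode t -> s = t.
Proof.
  revert t; induction s as [|n s IH]; intros [|m t] H; try easy.
  apply Nat.succ_inj, (f_equal of_nat) in H. rewrite !cancel_of_to in H.
  injection H as -> H. f_equal; auto.
Qed.

Lemma encode_retract : exists d : nat -> list nat, forall s, d (encode s) = s.
Proof.
  assert (H : forall k, exists s, forall s', encode s' = k -> s' = s).
  { intros k. destruct (classic (exists s, encode s = k)) as [[s <-]|n].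
    - exists s; intros; now apply encode_inj.
    - exists []; intros s' h; exfalso; eauto. }
  apply functional_choice in H as [d Hd]. exists d. intros s; symmetry; auto.
Qed.

(** * Comparison of trees *)

(* Finite sequences are listed with the most recent entry first. *)
Fixpoint initial (w : baire) (n : nat) : list nat :=
  match n with 0 => [] | S n => w n :: initial w n end.

Lemma length_initial (w : baire) (n : nat) : length (initial w n) = n.
Proof. induction n; simpl; auto. Qed.

Lemma initial_agree (w w' : baire) (n : nat) :
  initial w n = initial w' n <-> agree n w w'.
Proof.
  induction n as [|n IH]; simpl; [split; [intros _ i Hi; lia | easy]|].
  split.
  - intros H; injection H as h1 h2. apply IH in h2. intros i Hi.
    destruct (Nat.eq_dec i n) as [->|]; [easy | apply h2; lia].
  - intros H; f_equal; [apply H; lia | apply IH; intros i Hi; apply H; lia].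
Qed.

(** [w] is read as a function on codes of sequences. Applying it to every nonempty tail gives a map
    that preserves length and extension, so branches go to branches. *)
Fixpoint follow (w : baire) (s : list nat) : list nat :=
  match s with [] => [] | _ :: s' => w (encode s) :: follow w s' end.

Lemma follow_branch (w b : baire) :
  exists c, forall n, follow w (initial b n) = initial c n.
Proof.
  exists (fun n => w (encode (initial b (S n)))).
  induction n as [|n IH]; [easy|]. simpl. now rewrite IH.
Qed.

Lemma follow_local (w : baire) (s : list nat) :
  exists L, forall w', agree L w' w -> follow w' s = follow w s.
Proof.
  induction s as [|n s [L IH]]; [now exists 0|].
  exists (L + S (encode (n :: s))); intros w' H.
  cbn [follow]. f_equal; [apply H; lia | apply IH; intros i Hi; apply H; lia].
Qed.

(** An invariant for a game: one player extends [s], the other answers by extending [t] and must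
    stay in [B] as long as [s] stays in [A]. *)
Definition simulation (A B : list nat -> Prop) (Q : list nat -> list nat -> Prop) : Prop :=
  forall s t, Q s t -> A s -> B t /\ forall n, exists m, Q (n :: s) (m :: t).

Definition simulated (A B : list nat -> Prop) (s t : list nat) : Prop :=
  exists Q, simulation A B Q /\ Q s t.

Lemma simulation_follow (A B : list nat -> Prop) (Q : list nat -> list nat -> Prop) :
  (forall n s, A (n :: s) -> A s) -> simulation A B Q -> Q [] [] ->
  exists w, forall s, A s -> B (follow w s).
Proof.
  intros pA sQ Q0.
  assert (H : forall x : nat * list nat * list nat, exists m,
     let '(n, s, t) := x in Q s t -> A s -> Q (n :: s) (m :: t)).
  { intros [[n s] t]. destruct (classic (Q s t /\ A s)) as [[h1 h2]|]; [|exists 0; tauto].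
    destruct (sQ _ _ h1 h2) as [_ h]. destruct (h n) as [m h']; eauto. }
  apply functional_choice in H as [mv Hmv].
  (* [H s] is the play of the chosen answers against the moves [s]. *)
  set (H := fix H s := match s with [] => [] | n :: s => mv (n, s, H s) :: H s end).
  assert (HQ : forall s, A s -> Q s (H s)).
  { induction s as [|n s IH]; intros h; [easy|].
    pose proof (pA _ _ h) as h'. exact (Hmv (n, s, H s) (IH h') h'). }
  destruct encode_retract as [d Hd].
  (* The value at the code of [s] is the last answer to [s]. The default 0 is never reached, since
     [follow] consults only codes of nonempty sequences. *)
  exists (fun k => hd 0 (H (d k))). intros s h.
  assert (E : follow (fun k => hd 0 (H (d k))) s = H s).
  { clear h; induction s as [|n s IH]; [easy|].
    cbn [follow]. now rewrite IH, Hd. }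
  rewrite E. now apply (sQ s (H s) (HQ s h)).
Qed.

(* The failure of simulation in one direction is itself a simulation in the other; this
   replaces the comparison of the ranks of well-founded trees. *)
Lemma tree_compare (A B : list nat -> Prop) :
  (forall n s, A (n :: s) -> A s) -> (forall n s, B (n :: s) -> B s) ->
  (exists w, forall s, A s -> B (follow w s)) \/
  (exists w, forall s, B s -> A (follow w s)).
Proof.
  intros pA pB.
  destruct (classic (simulated A B [] [])) as [[Q [h1 h2]]|n].
  { left; now apply simulation_follow with Q. }
  right. apply simulation_follow with (fun t s => ~ simulated A B s t); auto.
  intros t s h Bt. split.
  - apply NNPP; intros nA. apply h. exists (fun s' t' => s' = s /\ t' = t); split; [|easy].
    now intros s' t' [-> ->].
  (* If [m :: t] simulated every extension of [s], the one answer [m] would meet all moves, and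
     adjoining the pair [s], [t] would give a simulation. *)
  - intros m. apply NNPP; intros h'. apply h.
    exists (fun s' t' => simulated A B s' t' \/ (s' = s /\ t' = t)); split; [|now right].
    intros s' t' [[Q [sQ hQ]] | [-> ->]] As.
    + destruct (sQ _ _ hQ As) as [h1 h2]; split; [easy|].
      intros k. destruct (h2 k) as [k' h3]. exists k'; left; now exists Q.
    + split; [easy|]. intros k. exists m. left. apply NNPP; intros h2; apply h'; now exists k.
Qed.

(** * A covering pair of analytic sets without a Borel reduction *)

Definition key (a : cantor) (s : list nat) : nat :=
  to_nat (encode (initial (fun i => Nat.b2n (a i)) (length s)), encode s).

Lemma key_inj (a a' : cantor) (w w' : baire) (n n' : nat) :
  key a (initial w n) = key a' (initial w' n') -> n = n' /\ agree n a a' /\ agree n w w'.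
Proof.
  unfold key; rewrite !length_initial. intros H.
  apply (f_equal of_nat) in H. rewrite !cancel_of_to in H. injection H as h1 h2.
  apply encode_inj in h1, h2.
  assert (n = n') as <- by (rewrite <- (length_initial w n), h2; apply length_initial).
  apply initial_agree in h1, h2. repeat split; auto.
  intros i Hi. apply Nat.b2n_inj. now apply h1.
Qed.

Lemma key_agree (a a' : cantor) (s : list nat) :
  agree (length s) a a' -> key a s = key a' s.
Proof.
  intros H; unfold key. do 3 f_equal. apply initial_agree.
  intros i Hi; f_equal; auto.
Qed.

(** A closed relation consists of the branches of its tree of finite approximations; [p] codes that
    tree for all [a] at once. *)
Lemma analytic_key (A : cantor -> Prop) :
  analytic A ->
  exists p : cantor, forall a, A a <-> exists w, forall n, p (key a (initial w n)) = true.
Proof.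
  intros [R [cR hR]].
  exists (fun k => dec_prop (exists a w n, R a w /\ key a (initial w n) = k)).
  intros a; rewrite hR; split; intros [w h]; exists w.
  - intros n. apply dec_propP. eauto.
  - apply cR. intros L. pose proof (h L) as hL.
    apply dec_propP in hL as (a' & w' & n & h1 & h2).
    apply key_inj in h2 as [-> ?]. eauto.
Qed.

(* The even and the odd part of [a] each code a tree on [nat], via membership of [key]s. *)
Fixpoint tree (b : bool) (a : cantor) (s : list nat) : Prop :=
  a (2 * key a s + Nat.b2n b) = true /\
  match s with [] => True | _ :: s => tree b a s end.

Lemma tree_tail (b : bool) (a : cantor) (n : nat) (s : list nat) :
  tree b a (n :: s) -> tree b a s.
Proof. now intros [_ h]. Qed.

Lemma tree_branch (b : bool) (a : cantor) (w : baire) :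
  (forall n, tree b a (initial w n)) <->
  (forall n, a (2 * key a (initial w n) + Nat.b2n b) = true).
Proof.
  split; intros H n.
  - specialize (H n). destruct n; apply H.
  - induction n as [|n IH]; split; auto; apply (H 0) || apply (H (S n)).
Qed.

Lemma tree_local (b : bool) (a : cantor) (s : list nat) :
  exists L, forall a', agree L a' a -> (tree b a' s <-> tree b a s).
Proof.
  assert (K : forall s L a', length s + (2 * key a s + 2) <= L -> agree L a' a ->
     a' (2 * key a' s + Nat.b2n b) = a (2 * key a s + Nat.b2n b)).
  { intros t L a' HL H. rewrite (key_agree a' a t) by (intros i Hi; apply H; lia).
    apply H. destruct b; simpl Nat.b2n; lia. }
  induction s as [|n s [L IH]]; eexists; intros a' H; cbn [tree].
  - erewrite K; [tauto | apply le_n | exact H].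
  - erewrite K with (L := _ + L); [rewrite IH; [tauto|] | | exact H].
    + intros i Hi; apply H. lia.
    + apply Nat.le_add_r.
Qed.

Definition reduces (b : bool) (a : cantor) (w : baire) : Prop :=
  forall s, tree b a s -> tree (negb b) a (follow w s).

(** For a fixed [s], the requirement reads only finitely many values of [a] and [w]. *)
Lemma reduces_closed (b : bool) : closed_rel (reduces b).
Proof.
  intros a w H s h.
  destruct (tree_local b a s) as [L1 h1].
  destruct (follow_local w s) as [L2 h2].
  destruct (tree_local (negb b) a (follow w s)) as [L3 h3].
  destruct (H (L1 + L2 + L3)) as (a' & w' & Ha & Hb & Hc).
  assert (sub : forall X L (f g : nat -> X), L <= L1 + L2 + L3 ->
     agree (L1 + L2 + L3) f g -> agree L f g) by (intros X L f g HL hfg i Hi; apply hfg; lia).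
  apply h3 with a'; [eapply sub; eauto; lia|].
  rewrite <- h2 with w' by (eapply sub; eauto; lia).
  apply Ha, h1; [eapply sub; eauto; lia | easy].
Qed.

Lemma reduces_branch (b : bool) (a : cantor) (w : baire) :
  reduces b a w ->
  (exists v, forall n, a (2 * key a (initial v n) + Nat.b2n b) = true) ->
  exists v, forall n, a (2 * key a (initial v n) + Nat.b2n (negb b)) = true.
Proof.
  intros hr [v hv]. rewrite <- tree_branch in hv.
  destruct (follow_branch w v) as [c hc]. exists c. apply tree_branch.
  intros n. rewrite <- hc. now apply hr.
Qed.

Lemma reduces_cover (a : cantor) :
  (exists w, reduces true a w) \/ (exists w, reduces false a w).
Proof. apply tree_compare; intros n s; apply tree_tail. Qed.

(* Diagonalization: [a] codes on its even part a tree witnessing [D] and on its odd part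
   one witnessing the complement of [D]; exactly one of these has a branch at [a]. *)
Lemma no_borel_reduction (D : cantor -> Prop) :
  borel D ->
  (forall a, D a -> exists w, reduces false a w) ->
  (forall a, ~ D a -> exists w, reduces true a w) -> False.
Proof.
  intros bD h1 h2. apply borel_bianalytic in bD as [aD aD'].
  apply analytic_key in aD as [p hp], aD' as [q hq].
  set (a := fun k => if Nat.even k then p (Nat.div2 k) else q (Nat.div2 k)).
  assert (ap : forall k, a (2 * k + Nat.b2n false) = p k).
  { intros k; unfold a. simpl Nat.b2n. rewrite Nat.add_0_r, Nat.even_even, Nat.div2_double. easy. }
  assert (aq : forall k, a (2 * k + Nat.b2n true) = q k).
  { intros k; unfold a. simpl Nat.b2n.
    rewrite Nat.even_odd, Nat.add_1_r, Nat.div2_succ_double. easy. }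
  assert (Dp : D a <-> exists v, forall n, a (2 * key a (initial v n) + Nat.b2n false) = true).
  { rewrite hp. split; intros [v h]; exists v; intros n; specialize (h n);
      [now rewrite ap | now rewrite ap in h]. }
  assert (Dq : ~ D a <-> exists v, forall n, a (2 * key a (initial v n) + Nat.b2n true) = true).
  { rewrite hq. split; intros [v h]; exists v; intros n; specialize (h n);
      [now rewrite aq | now rewrite aq in h]. }
  destruct (classic (D a)) as [h | h].
  - destruct (h1 a h) as [w hw]. apply reduces_branch in hw; [|now apply Dp].
    now apply Dq in hw.
  - destruct (h2 a h) as [w hw]. apply reduces_branch in hw; [|now apply Dq].
    now apply Dp in hw.
Qed.

(** * Ideals generated by closed hereditary families *)

Definition hereditary (C : cantor -> Prop) : Prop :=
  forall x y, subsetc y x -> C x -> C y.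

Definition color_class (k : nat) (c : nat -> nat) (x : cantor) (j : nat) : cantor :=
  fun n => x n && (k <=? n) && (c n =? j).

Lemma color_classP (k : nat) (c : nat -> nat) (x : cantor) (j n : nat) :
  color_class k c x j n = true <-> x n = true /\ k <= n /\ c n = j.
Proof.
  unfold color_class. rewrite !andb_true_iff, Nat.leb_le, Nat.eqb_eq. tauto.
Qed.

(** Covers are given by colourings because those with values below [k] form a compact space. The
    same [k] bounds the number of colours and the ignored initial segment. *)
Definition generated_upto (C : cantor -> Prop) (k : nat) (x : cantor) : Prop :=
  exists c, (forall n, c n < k) /\ forall j, C (color_class k c x j).

(* [C] and the finite sets generate this ideal: the elements below [k] are unconstrained. *)
Definition generated (C : cantor -> Prop) (x : cantor) : Prop :=
  exists k, generated_upto C k x.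

Lemma generated_ideal (C : cantor -> Prop) :
  hereditary C -> C emptyc -> is_ideal (generated C).
Proof.
  intros hC C0. split; [|split].
  - exists 1, (fun _ => 0); split; [lia|]. intros j. now apply hC with emptyc.
  - intros x y yx (k & c & h1 & h2). exists k, c; split; [easy|].
    intros j. apply hC with (2 := h2 j). intros n. rewrite !color_classP.
    intros [h ?]; auto.
  - intros x y (k & c & h1 & h2) (l & d & h3 & h4).
    (* Shifting the colours of [y] by [k] keeps them apart from those of [x]. *)
    exists (k + l), (fun n => if x n then c n else k + d n); split.
    { intros n; specialize (h1 n); specialize (h3 n); destruct (x n); lia. }
    intros j. destruct (Nat.lt_ge_cases j k).
    + apply hC with (2 := h2 j). intros n. rewrite !color_classP. unfold unionc.
      destruct (x n); simpl; [intuition lia|]. intros; lia.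
    + apply hC with (2 := h4 (j - k)). intros n. rewrite !color_classP. unfold unionc.
      specialize (h1 n). destruct (x n); simpl; [intros; lia | intuition lia].
Qed.

(** A cluster point of colourings for points approaching [x] is a colouring for [x]. *)
Lemma generated_upto_closed (C : cantor -> Prop) (k : nat) :
  is_closed C -> is_closed (generated_upto C k).
Proof.
  intros cC x nx. apply NNPP; intros H. apply nx.
  assert (H' : forall m, exists yc, agree m (fst yc) x /\ (forall n, snd yc n < k) /\
                 forall j, C (color_class k (snd yc) (fst yc) j)).
  { intros m. apply NNPP; intros H'. apply H. exists m. intros y Hy (c & h1 & h2).
    apply H'. now exists (y, c). }
  apply functional_choice in H' as [yc Hyc].
  destruct (bounded_cluster_point (fun m => snd (yc m))) as [g Hg].
  { intros j; exists k; intros m _. now apply Nat.lt_le_incl, Hyc. }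
  exists g; split.
  - intros n. destruct (Hg (S n) 0) as [m [_ h]]. rewrite <- h by lia. apply Hyc.
  - intros j. apply NNPP; intros h. apply cC in h as [L h].
    destruct (Hg L L) as [m [h1 h2]]. destruct (Hyc m) as (h3 & _ & h4).
    apply (h (color_class k (snd (yc m)) (fst (yc m)) j)); [|easy].
    intros i Hi. unfold color_class. rewrite h2, h3 by lia. easy.
Qed.

Lemma generated_Fsigma (C : cantor -> Prop) : is_closed C -> is_Fsigma (generated C).
Proof.
  intros cC. exists (generated_upto C); split; [|easy].
  intros n; now apply generated_upto_closed.
Qed.

Lemma generated_incl (C : cantor -> Prop) (x : cantor) : hereditary C -> C x -> generated C x.
Proof.
  intros hC h. exists 1, (fun _ => 0); split; [lia|]. intros j. apply hC with (2 := h).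
  intros n. rewrite color_classP. tauto.
Qed.

Lemma generated_infinite (C : cantor -> Prop) (x : cantor) :
  generated C x -> infinitec x -> exists y, subsetc y x /\ infinitec y /\ C y.
Proof.
  intros (k & c & h1 & h2) ix.
  destruct (pigeonhole (fun n => x n = true) c k) as [v hv].
  { intros M. destruct (ix M) as [n [? ?]]. exists n; repeat split; auto.
    now apply Nat.lt_le_incl. }
  exists (color_class k c x v); split; [|split; auto].
  - intros n; rewrite color_classP; tauto.
  - intros M. destruct (hv (M + k)) as (n & h3 & h4). exists n.
    rewrite color_classP. intuition lia.
Qed.

(** Infinite colour classes lie in [C'] by assumption; the finitely many finite ones are emptied by
    raising the threshold. *)
Lemma generated_restrict (C C' : cantor -> Prop) (x : cantor) :
  C' emptyc -> hereditary C' -> generated C x ->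
  (forall y, subsetc y x -> infinitec y -> C y -> C' y) -> generated C' x.
Proof.
  intros C0 hC (k & c & h1 & h2) H.
  destruct (eventually_all (fun j N => C' (color_class N c x j))) with (L := k) as [N HN].
  { intros j. destruct (classic (infinitec (color_class k c x j))) as [i | i].
    - exists k. intros m Hm. apply hC with (color_class k c x j).
      + intros n; rewrite !color_classP; intuition lia.
      + apply H; auto. intros n; rewrite color_classP; tauto.
    - apply not_all_ex_not in i as [M hM]. exists (k + M). intros m Hm.
      apply hC with (2 := C0). intros n Hn. exfalso. apply hM. exists n.
      rewrite color_classP in *. intuition lia. }
  exists (N + k), c; split.
  { intros n; specialize (h1 n); lia. }
  intros j. destruct (Nat.lt_ge_cases j k) as [Hj | Hj].
  - apply HN; lia.
  - apply hC with (2 := C0). intros n. rewrite color_classP. specialize (h1 n). lia.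
Qed.

(** * Families coding closed relations *)

Fixpoint count (y : cantor) (e : nat) : nat :=
  match e with 0 => 0 | S e => Nat.b2n (y e) + count y e end.

Lemma count_mono (y : cantor) (e e' : nat) : e <= e' -> count y e <= count y e'.
Proof. induction 1; simpl; lia. Qed.

Lemma count_subset (x y : cantor) (e : nat) : subsetc y x -> count y e <= count x e.
Proof.
  intros H; induction e as [|e IH]; simpl; [lia|].
  specialize (H e). destruct (y e); [rewrite H by easy | destruct (x e)]; simpl; lia.
Qed.

Lemma count_agree (x y : cantor) (e : nat) : agree e x y -> count x e = count y e.
Proof.
  induction e as [|e IH]; intros H; simpl; [easy|].
  rewrite IH, H by (lia || intros i Hi; apply H; lia). easy.
Qed.

Lemma count_unbounded (y : cantor) (j : nat) : infinitec y -> exists e, j <= count y e.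
Proof.
  intros iy; induction j as [|j [e IH]]; [exists 0; lia|].
  destruct (iy e) as [n [h1 h2]]. exists (S n). simpl. rewrite h2.
  apply (count_mono y) in h1. simpl; lia.
Qed.

(* The point [e] of [nat] stands for the finite binary sequence of its bits.  The elements
   of [y] converge to some [a] with [R a w], and the enumeration of [y] grows fast enough
   to dominate [w]. *)
Definition bound_ok (y : cantor) (a : cantor) (w : baire) (e : nat) : Prop :=
  forall j, j <= count y e -> w j <= e /\ Nat.testbit e j = a j.

(* A finite [y] needs only approximate witnesses; this makes the family closed although
   [w] ranges over a non-compact space. *)
Definition family (R : cantor -> baire -> Prop) (y : cantor) : Prop :=
  forall m, (exists e, e < m /\ y e = true) ->
  exists a w, R a w /\ forall e, e < m -> y e = true -> bound_ok y a w e.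

Lemma family_hereditary (R : cantor -> baire -> Prop) : hereditary (family R).
Proof.
  intros x y yx H m (e & h1 & h2).
  destruct (H m) as (a & w & h3 & h4); [exists e; auto|].
  exists a, w; split; [easy|]. intros e' h5 h6 j Hj. apply h4; auto.
  apply (count_subset x y e') in yx. lia.
Qed.

Lemma family_empty (R : cantor -> baire -> Prop) : family R emptyc.
Proof. now intros m (e & _ & h). Qed.

(** A failure of the clause for [m] is visible on [y] below [m]. *)
Lemma family_closed (R : cantor -> baire -> Prop) : is_closed (family R).
Proof.
  intros y H. apply not_all_ex_not in H as [m H]. exists m. intros z zy H'. apply H.
  intros (e & h1 & h2). destruct (H' m) as (a & w & h3 & h4).
  { exists e; split; [easy | now rewrite zy]. }
  exists a, w; split; [easy|]. intros e' h5 h6 j Hj. apply h4; auto.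
  - now rewrite zy.
  - rewrite (count_agree z y); [easy|]. intros i Hi; apply zy; lia.
Qed.

(** The set [x_a] of the overview: below its leading one, the bits of [e], lowest first, form an
    initial segment of [a]. *)
Definition codes (a : cantor) : cantor :=
  fun e => forallb (fun j => Bool.eqb (Nat.testbit e j) (a j)) (seq 0 (Nat.log2 e)).

Lemma codesP (a : cantor) (e : nat) :
  codes a e = true <-> forall j, j < Nat.log2 e -> Nat.testbit e j = a j.
Proof.
  unfold codes. rewrite forallb_forall. split; intros H j Hj.
  - apply eqb_prop, H, in_seq. lia.
  - apply eqb_true_iff, H. apply in_seq in Hj. lia.
Qed.

Lemma codes_infinite (a : cantor) : infinitec (codes a).
Proof.
  intros m.
  assert (H : forall m a, exists e, 0 < e /\ Nat.log2 e = m /\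
            forall j, j < m -> Nat.testbit e j = a j).
  { clear; induction m as [|m IH]; intros a; [exists 1; repeat split; auto; lia|].
    destruct (IH (fun i => a (S i))) as (e & h1 & h2 & h3).
    exists (2 * e + Nat.b2n (a 0)); repeat split; [lia | |].
    - destruct (a 0); simpl Nat.b2n.
      + rewrite Nat.log2_succ_double by lia. lia.
      + rewrite Nat.add_0_r, Nat.log2_double by lia. lia.
    - intros [|j] Hj.
      + rewrite Nat.add_comm. apply Nat.add_b2n_double_bit0.
      + rewrite <- h3 by lia. destruct (a 0); simpl Nat.b2n.
        * apply Nat.testbit_odd_succ; lia.
        * rewrite Nat.add_0_r. apply Nat.testbit_even_succ; lia. }
  destruct (H m a) as (e & h1 & h2 & h3). exists e; split.
  - rewrite <- h2. now apply Nat.log2_le_lin, Nat.lt_le_incl.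
  - apply codesP. now rewrite h2.
Qed.

Lemma codes_continuous (a : cantor) (k : nat) :
  exists l, forall a', agree l a' a -> agree k (codes a') (codes a).
Proof.
  exists k. intros a' H e He. apply eq_true_iff_eq. rewrite !codesP.
  split; intros h j Hj; pose proof (Nat.log2_le_lin e (Nat.le_0_l e));
    [rewrite <- H by lia | rewrite H by lia]; auto.
Qed.

(** Each [j] has an element [e] of [y] late and long enough to bound [w j] by [e] and to fix
    coordinate [j] to [a j] in all later approximate witnesses. These therefore cluster at some pair
    [a], [w], and [R] is closed. *)
Lemma family_codes (R : cantor -> baire -> Prop) (a : cantor) (y : cantor) :
  closed_rel R -> family R y -> infinitec y -> subsetc y (codes a) -> exists w, R a w.
Proof.
  intros cR hy iy ya.
  destruct (iy 0) as (e0 & _ & he0).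
  assert (H : forall m, exists aw, R (fst aw) (snd aw) /\
    forall e, e < m + S e0 -> y e = true -> bound_ok y (fst aw) (snd aw) e).
  (* The offset [S e0] keeps an element of [y] below the cutoff, as [family] requires. *)
  { intros m. destruct (hy (m + S e0)) as (b & w & h).
    - exists e0; split; [lia | easy].
    - now exists (b, w). }
  apply functional_choice in H as [aw Haw].
  assert (D : forall j, exists e, y e = true /\ j <= count y e /\ j < Nat.log2 e).
  { intros j. destruct (count_unbounded y j iy) as [e1 h1].
    destruct (iy (e1 + 2 ^ S j)) as [e [h2 h3]]. exists e; repeat split; auto.
    - rewrite h1. apply count_mono; lia.
    - pose proof (Nat.pow_gt_lin_r 2 (S j) ltac:(lia)).
      apply (Nat.log2_le_pow2 e (S j)); lia. }
  destruct (bounded_cluster_point (fun m => snd (aw m))) as [w Hw].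
  { intros j. destruct (D j) as (e & h1 & h2 & h3). exists (S e). intros m Hm.
    destruct (Haw m) as [_ h]. specialize (h e ltac:(lia) h1 j h2). lia. }
  exists w. apply cR. intros L.
  destruct (eventually_all (fun j m => fst (aw m) j = a j)) with (L := L) as [N HN].
  { intros j. destruct (D j) as (e & h1 & h2 & h3). exists (S e). intros m Hm.
    destruct (Haw m) as [_ h]. destruct (h e ltac:(lia) h1 j h2) as [_ <-].
    apply ya in h1. now apply (proj1 (codesP a e)). }
  destruct (Hw L N) as [m [h1 h2]].
  exists (fst (aw m)), (snd (aw m)). split; [apply Haw | split]; [|easy].
  intros i Hi. now apply HN.
Qed.

Lemma infinite_limit_point (x : cantor) :
  infinitec x -> exists a : cantor, forall L M, exists e,
    M <= e /\ x e = true /\ agree L (Nat.testbit e) a.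
Proof.
  intros ix. apply functional_choice in ix as [e He].
  destruct (bounded_cluster_point (fun m j => Nat.b2n (Nat.testbit (e m) j))) as [g Hg].
  { intros j; exists 1; intros m _. destruct (Nat.testbit (e m) j); simpl; lia. }
  exists (fun j => g j =? 1). intros L M. destruct (Hg L M) as [m [h1 h2]].
  destruct (He m) as [h3 h4]. exists (e m); repeat split; [lia | easy |].
  intros j Hj. rewrite <- h2 by easy. now destruct (Nat.testbit (e m) j).
Qed.

(** Greedy selection: [e] is accepted when it meets the bounds for the number [c e] of elements
    accepted before it. *)
Lemma family_thinning (R : cantor -> baire -> Prop) (x a : cantor) (w : baire) :
  (forall L M, exists e, M <= e /\ x e = true /\ agree L (Nat.testbit e) a) ->
  R a w -> exists y, subsetc y x /\ infinitec y /\ family R y.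
Proof.
  intros lim h.
  set (good := fun e c => dec_prop (x e = true /\
    forall j, j <= c -> w j <= e /\ Nat.testbit e j = a j)).
  set (c := fix c e := match e with 0 => 0 | S e => Nat.b2n (good e (c e)) + c e end).
  set (y := fun e => good e (c e)).
  assert (cnt : forall e, count y e = c e).
  { induction e as [|e IH]; [easy|]. simpl. now rewrite IH. }
  exists y; split; [|split].
  - intros e He. now apply dec_propP in He as [? _].
  (* If nothing were accepted from [M] on, [c] would stay constant and leave finitely many
     conditions, which some large element of [x] near [a] satisfies. *)
  - intros M. apply NNPP; intros n.
    assert (const : forall e, M <= e -> c e = c M).
    { induction 1 as [|e He IH]; [easy|]. simpl.
      destruct (good e (c e)) eqn:E; [|easy]. exfalso; apply n; now exists e. }
    destruct (eventually_all (fun j e => w j <= e)) with (L := S (c M)) as [N HN].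
    { intros j; now exists (w j). }
    destruct (lim (S (c M)) (M + N)) as (e & h1 & h2 & h3).
    apply n. exists e; split; [lia|]. apply dec_propP. rewrite const by lia.
    split; [easy|]. intros j Hj. split; [apply HN; lia | apply h3; lia].
  - intros m _. exists a, w; split; [easy|]. intros e _ He j Hj.
    rewrite cnt in Hj. apply dec_propP in He as [_ He]. auto.
Qed.

(** * The tall ideal and the refutation of a selector *)

Lemma closed_union (A B : cantor -> Prop) :
  is_closed A -> is_closed B -> is_closed (fun x => A x \/ B x).
Proof.
  intros cA cB x H. apply not_or_and in H as [h1 h2].
  apply cA in h1 as [k h1]. apply cB in h2 as [l h2].
  exists (k + l). intros y Hy [h | h].
  - apply (h1 y); auto. intros i Hi; apply Hy; lia.
  - apply (h2 y); auto. intros i Hi; apply Hy; lia.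
Qed.

Theorem theorem4 :
  exists I : cantor -> Prop,
    is_ideal I /\ is_Fsigma I /\ tall I /\
    ~ (exists S : cantor -> cantor, borel_selector I S).
Proof.
  set (C := fun b => family (reduces b)).
  assert (hC : hereditary (fun y => C false y \/ C true y)).
  { intros x y yx [h | h]; [left | right]; now apply family_hereditary with x. }
  exists (generated (fun y => C false y \/ C true y)).
  split; [|split; [|split]].
  - apply generated_ideal; [easy|]. left; apply family_empty.
  - apply generated_Fsigma, closed_union; apply family_closed.
  - intros x ix. destruct (infinite_limit_point x ix) as [a lim].
    assert (H : exists y, subsetc y x /\ infinitec y /\ (C false y \/ C true y)).
    { destruct (reduces_cover a) as [[w h] | [w h]];
        destruct (family_thinning _ x a w lim h) as (y & h1 & h2 & h3);
        exists y; unfold C; auto. }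
    destruct H as (y & h1 & h2 & h3). exists y; repeat split; auto.
    now apply generated_incl.
  - intros [S [bS hS]].
    assert (iS : forall a, infinitec (S (codes a))).
    { intros a. now apply hS, codes_infinite. }
    assert (sub : forall a y, subsetc y (S (codes a)) -> subsetc y (codes a)).
    { intros a y h n Hn. now apply hS, h. }
    apply (no_borel_reduction (fun a => generated (C false) (S (codes a)))).
    + apply borel_continuous_preimage with (A := fun z => generated (C false) (S z)).
      { intros; apply codes_continuous. }
      destruct (generated_Fsigma (C false)) as [F [cF hF]]; [apply family_closed|].
      apply borel_ext with (fun z => exists n, F n (S z)).
      2: { intros z; now rewrite hF. }
      apply borel_cunion. intros n.
      apply borel_ext with (fun z => ~ ~ F n (S z)).
      2: { intros z; split; [apply NNPP | tauto]. }
      apply (borel_compl (fun z => ~ F n (S z))). apply (bS (fun z => ~ F n z)), cF.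
    (* An infinite colour class of [S (codes a)] lies in [C false] and so yields a reduction. *)
    + intros a h. apply generated_infinite in h as (y & h1 & h2 & h3); auto.
      apply family_codes with y; auto using reduces_closed.
    (* Without a witness for [reduces true a], no infinite subset of [codes a] is in [C true], so
       [C false] alone generates [S (codes a)]. *)
    + intros a h. apply NNPP; intros h'. apply h.
      apply generated_restrict with (fun y => C false y \/ C true y).
      * apply family_empty.
      * apply family_hereditary.
      * apply hS.
      * intros y h1 h2 [h3 | h3]; [easy|]. exfalso. apply h'.
        apply family_codes with y; auto using reduces_closed.
Qed.
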